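(* Let $\alpha = \lim_{h\to\infty} \mathrm{cost}(M_h)/|M_h|$, where $M_h$ is the maximal binary tree of height $h$ and $\mathrm{cost}(T)$ is the number of rotations in the splay-to-root traversal of $T$. Then the decimal expansion of $\alpha$ begins with the following 3009 characters (one digit, the decimal point, and 3007 decimal places; line breaks are to be ignored), i.e. all 3007 displayed decimal places of $\alpha$ are correct: 2.41464532311342664135721059929950736447077229680868005373357354525826 2740624105270973536945896664894612383387133140143583762512616478135561 4286064288849821865109967561998433943559594398275126178907483349665025 5080091545859089478186004505638394411483898674045412979196509367417534 6878187831010615663204826748679513555160671568781383651194277803644514 9238821898220035037296172434065926647433143400078616634513025688467682 6171027174616776487580847038386785938892724884200227357265301260112929 0242872683045128992893355401230833822607056585290386388421722662334074 0116380336801125542664867713593347299299395197919439890378605878338449 0684574027066720810192492640915295144745925864171925599305806057575314 2508105256778113408318294187577539205456236837958433846424262409916448 9697233372775761982930647206283833774577192257755235647190176672592133 2949875562869242099200719629819461975554171376684916338003857643161270 0747640412245784792115264723755558116173763305314958459449252363780334 3121387447870909378536449539445023339622338606613085762454506694594937 1377070000570876683583128296299442896491275160724353720907079555723091 7471898153816752661145112486336096680922635899639696366033792702634139 2837615929543809383793534957141012590712487704983953605803254154040608 8106227758784127307004889163446215318322212040230203240483964362931477 7176498520706885768943453560729740034369991068278397299835094676979973 0685469380069957582763661847207759482022362106606817207185249175670881 9473275669722948259829248370547849180846820987183968707971251129981407 9773527676551260720609151582081068413751466710205527377054258149097152 9289561262502780864046114682107387796782939836021136317806326521145487 6760227391835198547411927129861199542826677693150395041342412196574665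 4473060865865080514373454048919553626044024615908890117833068246524507 0089664144159195043023934386059335422404227281126486873705576624384602 9528750910516010997873931055591565295205182888286563627909743235573390 9689133141395995283844816911095381106026450878554652596426441091822593 2390806913732320816254273685041076786682097197712812201979942001490611 7626168639781158815517923973646158921003560714955895298284159796312644 0396095898620587149904372166146231321103503671310912936678042493588535 2505353868931579424411182910431741623568322771304576555905031402969234 4660957154696322464495584555868741912213583503440498876463365928113074 9233658183765301672791687233629880536085398659358936376703856335909377 6948499772272644410353046707274139060905827949996769797881256122388937 2692185590090760815441293071672841610891695407335595431360249781445226 4120383844036525829611612062383372947896234386973096119274358253660018 7150107446002431807957835268023887676251646716118886314819424666594719 2923138902667033619091930830078377030802184358525745880030925494397385 5546393947770581175494013381395303045868156058494995588030890182315469 2099632400578717275003880135554963167113109913616699600867929624278862 052537884913130875294295119205291521849749337282042856555796587734387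
   Context: ''Tree'' means finite binary tree (each node has a possibly empty left subtree and a possibly empty right subtree); $|T|$ is the number of nodes of $T$. The height of a nonempty tree is the number of links on a longest path from the root to a leaf. $M_h$ denotes the maximal tree of height $h$, i.e. the unique (up to isomorphism) tree of height $h$ with $2^{h+1}-1$ nodes. Splaying a node $x$ to the root (Sleator–Tarjan): while $x$ is not the root, let $p$ be its parent. If $p$ is the root, rotate the edge $xp$ (''zig'', 1 rotation). Otherwise let $g$ be the parent of $p$. If $x$ and $p$ are both left children or both right children, first rotate the edge $pg$, then the edge $xp$ (''zigzig'', 2 rotations). Otherwise rotate the edge $xp$ and then the edge joining $x$ to $g$ (''zigzag'', 2 rotations). Rotations preserve the inorder of the nodes. The splay-to-root traversal of $T$ splays to the root, one after another in inorder (first to last), every node of $T$, each time in the current tree. $\mathrm{cost}(T)$ is the total number of rotations performed in this traversal. The limit defining $\alpha$ exists. *)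

(* Defs.v *)
From Stdlib Require Import Reals List Arith ZArith Lia.
Import ListNotations.

Set Implicit Arguments.

Inductive tree (A : Type) : Type :=
| Empty : tree A
| Node : tree A -> A -> tree A -> tree A.

Arguments Empty {A}.

Fixpoint size A (t : tree A) : nat :=
  match t with
  | Empty => 0
  | Node l _ r => S (size l + size r)
  end.

Fixpoint inorder A (t : tree A) : list A :=
  match t with
  | Empty => []
  | Node l x r => inorder l ++ x :: inorder r
  end.

(* Number of links on a longest path from the root to a leaf; the value at
   [Empty] is a convention. *)
Fixpoint height A (t : tree A) : nat :=
  match t with
  | Empty => 0
  | Node Empty _ Empty => 0
  | Node l _ r => S (Nat.max (height l) (height r))
  end.

(* [rotate_right] and [rotate_left] rotate the edge joining the root to its
   left, respectively right, child. *)
Definition rotate_right A (t : tree A) : tree A :=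
  match t with
  | Node (Node a x b) y c => Node a x (Node b y c)
  | _ => t
  end.

Definition rotate_left A (t : tree A) : tree A :=
  match t with
  | Node a x (Node b y c) => Node (Node a x b) y c
  | _ => t
  end.

(* A strict ancestor [p] of a given node: [LeftOf p r] if the node lies in the
   left subtree of [p], whose right subtree is [r], and [RightOf l p] if it lies
   in the right subtree of [p], whose left subtree is [l]. *)
Inductive frame (A : Type) : Type :=
| LeftOf : A -> tree A -> frame A
| RightOf : tree A -> A -> frame A.

(* [splay_up k t] moves the root of [t] to the root of the whole tree in which
   [t] is the subtree with ancestors [k], parent first; it returns the resulting
   tree and the number of rotations. *)
Fixpoint splay_up A (k : list (frame A)) (t : tree A) : tree A * nat :=
  match k with
  | [] => (t, 0)
  (* zig *)
  | [LeftOf p c] => (rotate_right (Node t p c), 1)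
  | [RightOf c p] => (rotate_left (Node c p t), 1)
  (* zigzig *)
  | LeftOf p c :: LeftOf g d :: k' =>
      let (u, n) :=
        splay_up k' (rotate_right (rotate_right (Node (Node t p c) g d))) in
      (u, 2 + n)
  | RightOf c p :: RightOf d g :: k' =>
      let (u, n) :=
        splay_up k' (rotate_left (rotate_left (Node d g (Node c p t)))) in
      (u, 2 + n)
  (* zigzag *)
  | RightOf c p :: LeftOf g d :: k' =>
      let (u, n) :=
        splay_up k' (rotate_right (Node (rotate_left (Node c p t)) g d)) in
      (u, 2 + n)
  | LeftOf p c :: RightOf d g :: k' =>
      let (u, n) :=
        splay_up k' (rotate_left (Node d g (rotate_right (Node t p c)))) in
      (u, 2 + n)
  end.

(* The ancestors, parent first, and the subtree of the first node named [x] of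
   [t], where [k] are the ancestors of the root of [t]. *)
Fixpoint locate (x : nat) (t : tree nat) (k : list (frame nat)) :
    option (list (frame nat) * tree nat) :=
  match t with
  | Empty => None
  | Node l y r =>
      if x =? y then Some (k, t)
      else match locate x l (LeftOf y r :: k) with
           | Some z => Some z
           | None => locate x r (RightOf l y :: k)
           end
  end.

Definition splay (x : nat) (t : tree nat) : tree nat * nat :=
  match locate x t [] with
  | Some (k, s) => splay_up k s
  | None => (t, 0)
  end.

Fixpoint splay_all (xs : list nat) (t : tree nat) : nat :=
  match xs with
  | [] => 0
  | x :: xs' => let (u, n) := splay x t in n + splay_all xs' u
  end.

(* Names the nodes [k], [k + 1], ... in inorder, so that each node can be
   followed through the rotations. *)
Fixpoint name A (k : nat) (t : tree A) : tree nat :=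
  match t with
  | Empty => Empty
  | Node l _ r =>
      Node (name k l) (k + size l) (name (S (k + size l)) r)
  end.

Definition cost A (t : tree A) : nat :=
  splay_all (inorder (name 0 t)) (name 0 t).

(* The maximal tree of height [h]; see [maximal_spec]. *)
Fixpoint maximal (h : nat) : tree unit :=
  match h with
  | 0 => Node Empty tt Empty
  | S h' => Node (maximal h') tt (maximal h')
  end.

Lemma height_node A (l : tree A) x r :
  (l = Empty /\ r = Empty) \/
  height (Node l x r) = S (Nat.max (height l) (height r)).
Proof.
  destruct l; destruct r; (left; split; reflexivity) || (right; reflexivity).
Qed.

Lemma size_le A (t : tree A) : S (size t) <= 2 ^ S (height t).
Proof.
  induction t as [|l IHl x r IHr]; [simpl; lia|].
  destruct (height_node l x r) as [[-> ->] | ->]; [simpl; lia|].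
  set (m := Nat.max (height l) (height r)).
  assert (2 ^ S (height l) <= 2 ^ S m) by (apply Nat.pow_le_mono_r; lia).
  assert (2 ^ S (height r) <= 2 ^ S m) by (apply Nat.pow_le_mono_r; lia).
  rewrite (Nat.pow_succ_r' 2 (S m)); cbn [size]; lia.
Qed.

Lemma size_maximal (h : nat) : S (size (maximal h)) = 2 ^ S h.
Proof.
  induction h as [|h IH]; [reflexivity|].
  rewrite (Nat.pow_succ_r' 2 (S h)); cbn [maximal size]; lia.
Qed.

Lemma maximal_spec (h : nat) (t : tree unit) :
  t = maximal h <-> t <> Empty /\ height t = h /\ size t = 2 ^ (h + 1) - 1.
Proof.
  split.
  - intros ->; rewrite Nat.add_1_r, <- size_maximal; repeat split.
    + destruct h; discriminate.
    + induction h as [|h IH]; [reflexivity|]; cbn [maximal].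
      destruct (height_node (maximal h) tt (maximal h)) as [[E _] | ->].
      * destruct h; discriminate.
      * now rewrite IH, Nat.max_id.
    + lia.
  - rewrite Nat.add_1_r.
    revert t; induction h as [|h IH]; intros [|l [] r] (Ht & Hh & Hs);
      try (now destruct Ht); destruct (height_node l tt r) as [[-> ->] | E].
    + reflexivity.
    + rewrite E in Hh; discriminate.
    + discriminate.
    + rewrite E in Hh; injection Hh as Hm.
      assert (Hl := size_le l); assert (Hr := size_le r).
      assert (2 ^ S (height l) <= 2 ^ S h) by (apply Nat.pow_le_mono_r; lia).
      assert (2 ^ S (height r) <= 2 ^ S h) by (apply Nat.pow_le_mono_r; lia).
      rewrite (Nat.pow_succ_r' 2 (S h)) in Hs; cbn [size] in Hs.
      assert (2 <= 2 ^ S h) by (apply (Nat.pow_le_mono_r 2 1); lia).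
      assert (Heq : forall u : tree unit, height u <= h ->
                S (size u) = 2 ^ S h -> u = maximal h).
      { intros u Hu Su; apply IH; repeat split; [intros -> | | lia].
        - simpl in Su; lia.
        - apply Nat.le_antisymm; [assumption|].
          apply Nat.succ_le_mono, (Nat.pow_le_mono_r_iff 2); [lia|].
          rewrite <- Su; apply size_le. }
      cbn [maximal]; f_equal; apply Heq; lia.
Qed.

Lemma inorder_name A (t : tree A) k : inorder (name k t) = seq k (size t).
Proof.
  revert k; induction t as [|l IHl x r IHr]; intro k; [reflexivity|].
  cbn [inorder name size].
  rewrite IHl, IHr, <- (Nat.add_succ_r (size l) (size r)), seq_app; reflexivity.
Qed.

(* One digit and 3007 decimals; the literal denotes the exact fraction with
   denominator [10 ^ 3007]. *)
Definition alpha_digits : R :=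
  2.4146453231134266413572105992995073644707722968086800537335735452582627406241052709735369458966648946123833871331401435837625126164781355614286064288849821865109967561998433943559594398275126178907483349665025508009154585908947818600450563839441148389867404541297919650936741753468781878310106156632048267486795135551606715687813836511942778036445149238821898220035037296172434065926647433143400078616634513025688467682617102717461677648758084703838678593889272488420022735726530126011292902428726830451289928933554012308338226070565852903863884217226623340740116380336801125542664867713593347299299395197919439890378605878338449068457402706672081019249264091529514474592586417192559930580605757531425081052567781134083182941875775392054562368379584338464242624099164489697233372775761982930647206283833774577192257755235647190176672592133294987556286924209920071962981946197555417137668491633800385764316127007476404122457847921152647237555581161737633053149584594492523637803343121387447870909378536449539445023339622338606613085762454506694594937137707000057087668358312829629944289649127516072435372090707955572309174718981538167526611451124863360966809226358996396963660337927026341392837615929543809383793534957141012590712487704983953605803254154040608810622775878412730700488916344621531832221204023020324048396436293147771764985207068857689434535607297400343699910682783972998350946769799730685469380069957582763661847207759482022362106606817207185249175670881947327566972294825982924837054784918084682098718396870797125112998140797735276765512607206091515820810684137514667102055273770542581490971529289561262502780864046114682107387796782939836021136317806326521145487676022739183519854741192712986119954282667769315039504134241219657466544730608658650805143734540489195536260440246159088901178330682465245070089664144159195043023934386059335422404227281126486873705576624384602952875091051601099787393105559156529520518288828656362790974323557339096891331413959952838448169110953811060264508785546525964264410918225932390806913732320816254273685041076786682097197712812201979942001490611762616863978115881551792397364615892100356071495589529828415979631264403960958986205871499043721661462313211035036713109129366780424935885352505353868931579424411182910431741623568322771304576555905031402969234466095715469632246449558455586874191221358350344049887646336592811307492336581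837653016727916872336298805360853986593589363767038563359093776948499772272644410353046707274139060905827949996769797881256122388937269218559009076081544129307167284161089169540733559543136024978144522641203838440365258296116120623833729478962343869730961192743582536600187150107446002431807957835268023887676251646716118886314819424666594719292313890266703361909193083007837703080218435852574588003092549439738555463939477705811754940133813953030458681560584949955880308901823154692099632400578717275003880135554963167113109913616699600867929624278862052537884913130875294295119205291521849749337282042856555796587734387%R.

(* Main.v *)
Require Import Defs.
From Stdlib Require Import Reals QArith Qreals List Arith ZArith NArith Lia Lra Bool.
Import ListNotations.
Open Scope nat_scope.

(** Once a node [x] has been splayed to the root, all nodes still to be visited
    form the right subtree of the root, and the next one is at the bottom of the
    left spine of that subtree.  Reading a tree as the list of the right
    subtrees along its left spine, bottom first, turns trees into nested lists
    [x0; c1; ...; ck].  Visiting the first node then costs [k + 1] rotations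
    and leaves the list [x0 ++ [c1 ++ [c2]; c3 ++ [c4]; ...]], with [ck] left
    unpaired when [k] is odd ([shrink]).  The number of rotations is [traversal],
    up to one rotation saved by the very first splay ([cost_maximal]).

    The maximal tree is [full (S n) = Snoc (full n) (full n)].  An element put at
    the end of a list [t] stays intact until it is alone, and costs one rotation
    for each step at which it is at the outermost level; the number of these
    steps, [surplus t], does not depend on the element ([surplus_spec]).  The
    surplus is itself additive, [surplus (Snoc t u) = delay t + surplus u], and
    [delay] obeys a recursion that prunes hard: it is 1 on lists of odd
    length, and [1 + delay (pairs z) + delay c] on a list [Snoc z c] of even
    length.  Summing up, the limit is
      [alpha = 1 + sum over n of delay (full n) / 2 ^ (n + 1)],
    and [approx n] is the partial sum ([approx_S], [ratio_cv]).

    The tail of this series needs [delay (full n)] to be much smaller than the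
    size [2 ^ n].  Iterate [t |-> pairs z] on [Snoc z c] while lengths are even:
    if two lists share a long enough beginning and both survive [j] rounds, then
    their lengths agree modulo [2 ^ j] ([live_congruent]).  Let [full n] survive
    [q + 1] rounds, with [2 ^ (q + 2) <= n + 2].  The element detached in round
    [q], and all the elements detached in turn when it is taken apart, begin with
    [full m] for [m = n - 2 ^ (q + 1) + 1] and have length at most [n - 1],
    because heights never grow.  If such a list survives [i] rounds, its length
    is [n] modulo [2 ^ min(i, q + 1)], so the number [d] of its elements beyond
    [full m] satisfies [2 ^ i <= d + 1].  But [i] rounds consume only [2 ^ i - 1]
    elements from the end: the beginning [full m] is never reached, and the
    delay is bounded by the size of what lies above it ([delay_final_stage]).
    This gives [delay (full n) <= 2 ^ (2 ^ k + 1)] if [full n] does not survive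
    [k] rounds and [2 ^ (k + 1) <= n + 2], and [2 ^ (n - n / 4 + 1)] for all
    [n >= 8].

    It remains to compute.  The sum up to [n = 10512] is evaluated exactly.  By
    the congruence, the [n] for which [full n] survives 9, respectively 12,
    rounds lie in one residue class modulo 512, respectively 4096; evaluating
    [delay] for the few of them that are relevant shows that all the terms up to
    [n = 40960] are small, and the general bound covers the rest.  The omitted
    part of the series is at most [3 / 2 ^ 9999], which is far smaller than the
    distance of the partial sum to the upper end of the required interval. *)

(** * Trees as nested lists *)

(** A tree read as the list of the right subtrees along its left spine, bottom
    first: [Snoc l c] is the list [l] followed by the element [c], and it is also
    the unlabelled binary tree with subtrees [l] and [c]. *)
Inductive bin : Type := Nil | Snoc (l c : bin).

Fixpoint len (t : bin) : nat :=
  match t with Nil => 0 | Snoc l _ => S (len l) end.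

Fixpoint weight (t : bin) : nat :=
  match t with Nil => 0 | Snoc l c => S (weight l + weight c) end.

Fixpoint levels (t : bin) : nat :=
  match t with Nil => 0 | Snoc l c => S (Nat.max (levels l) (levels c)) end.

(** Meaningful on lists of odd length: the first element is replaced by its own
    elements, and the others are merged two by two, [c1] and [c2] giving
    [Snoc c1 c2], which is what a zigzig does to two spine nodes. *)
Fixpoint pairs (t : bin) : bin :=
  match t with
  | Nil => Nil
  | Snoc Nil c => c
  | Snoc (Snoc l c1) c2 => Snoc (pairs l) (Snoc c1 c2)
  end.

(** The right subtree of the root after one more splay.  With an even number of
    elements the last one is left over: its node takes part in the final zigzag
    with the root. *)
Definition shrink (t : bin) : bin :=
  if Nat.odd (len t) then pairs t
  else match t with Nil => Nil | Snoc l c => Snoc (pairs l) c end.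

Lemma odd_S n : Nat.odd (S n) = negb (Nat.odd n).
Proof. now rewrite Nat.odd_succ, <- Nat.negb_odd. Qed.

Lemma bin_pair_ind (P : bin -> Prop) :
  P Nil -> (forall c, P (Snoc Nil c)) ->
  (forall l c1 c2, P l -> P (Snoc (Snoc l c1) c2)) -> forall t, P t.
Proof.
  intros H0 H1 H2 t.
  enough (P t /\ forall c, P (Snoc t c)) by tauto.
  induction t as [|l IH c _]; [auto|].
  split; [apply IH | intro; apply H2, IH].
Qed.

Lemma bin_weight_ind (P : bin -> Prop) :
  (forall t, (forall u, weight u < weight t -> P u) -> P t) -> forall t, P t.
Proof. exact (induction_ltof1 bin weight P). Qed.

Lemma weight_pairs t : Nat.odd (len t) = true -> S (weight (pairs t)) = weight t.
Proof.
  induction t as [|c|l c1 c2 IH] using bin_pair_ind; cbn [pairs weight len].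
  - discriminate.
  - reflexivity.
  - rewrite !odd_S, negb_involutive; intros H; specialize (IH H); lia.
Qed.

Lemma len_pairs_ge t : len t <= S (2 * len (pairs t)).
Proof.
  induction t using bin_pair_ind; cbn [pairs len]; lia.
Qed.

Lemma levels_pairs t : levels (pairs t) <= S (levels t).
Proof.
  induction t using bin_pair_ind; cbn [pairs levels]; lia.
Qed.

Lemma len_le_levels t : len t <= levels t.
Proof. induction t; cbn [len levels]; lia. Qed.

Lemma weight_shrink t : t <> Nil -> S (weight (shrink t)) = weight t.
Proof.
  unfold shrink; destruct (Nat.odd (len t)) eqn:E; [intros _; now apply weight_pairs|].
  destruct t as [|l c]; [easy|intros _].
  cbn [len] in E; rewrite odd_S, negb_false_iff in E.
  apply weight_pairs in E; cbn [weight]; lia.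
Qed.

(** * The recursion for the number of rotations *)
Fixpoint traversal_steps (n : nat) (t : bin) : nat :=
  match n with 0 => 0 | S n => len t + traversal_steps n (shrink t) end.

Definition traversal (t : bin) : nat := traversal_steps (weight t) t.

Lemma traversal_step t : traversal t = len t + traversal (shrink t).
Proof.
  destruct t as [|l c]; [reflexivity|].
  unfold traversal; set (t := Snoc l c).
  now rewrite <- (weight_shrink t) by easy.
Qed.

Lemma traversal_odd t :
  Nat.odd (len t) = true -> traversal t = len t + traversal (pairs t).
Proof. intro H; rewrite traversal_step; unfold shrink; now rewrite H. Qed.

Lemma traversal_even l c :
  Nat.odd (len l) = true ->
  traversal (Snoc l c) = S (len l) + traversal (Snoc (pairs l) c).
Proof.
  intro H; rewrite traversal_step; unfold shrink; cbn [len].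
  now rewrite odd_S, H.
Qed.

Definition surplus (t : bin) : nat := traversal (Snoc t Nil) - S (traversal t).

(** The element [u] is only moved around, never altered, while [t] is processed:
    [shrink] either leaves it last or appends it to the last element of [t], from
    where it comes back when that element is opened.  So its only effect is one
    more rotation whenever it is at the outermost level. *)
Lemma surplus_spec t u :
  traversal (Snoc t u) = traversal t + surplus t + S (traversal u).
Proof.
  enough (exists g, forall u,
    traversal (Snoc t u) = traversal t + g + S (traversal u)) as [g Hg].
  { unfold surplus; rewrite !Hg; change (traversal Nil) with 0; lia. }
  clear u; induction t as [t IH] using bin_weight_ind.
  destruct (Nat.odd (len t)) eqn:E.
  - destruct (IH (pairs t)) as [g Hg]; [apply weight_pairs in E; lia|].
    exists (S g); intro u.
    rewrite (traversal_even t u E), Hg, (traversal_odd t E); lia.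
  - destruct t as [|z c].
    { exists 0; intro u; rewrite traversal_odd by reflexivity; reflexivity. }
    cbn [len] in E; rewrite odd_S, negb_false_iff in E.
    assert (W := weight_pairs z E).
    destruct (IH (pairs z)) as [g1 H1]; [cbn [weight]; lia|].
    destruct (IH c) as [g2 H2]; [cbn [weight]; lia|].
    exists (S g2); intro u.
    rewrite (traversal_odd (Snoc (Snoc z c) u)) by (cbn [len]; now rewrite !odd_S, E).
    cbn [pairs len]; rewrite H1, H2, (traversal_even z c E), H1; lia.
Qed.

Lemma surplus_Nil : surplus Nil = 0.
Proof. reflexivity. Qed.

Lemma surplus_odd t : Nat.odd (len t) = true -> surplus t = S (surplus (pairs t)).
Proof.
  intro E; assert (H := surplus_spec t Nil).
  rewrite traversal_even, surplus_spec, (traversal_odd t E) in H by exact E; lia.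
Qed.

Lemma surplus_even z c : Nat.odd (len z) = true -> surplus (Snoc z c) = S (surplus c).
Proof.
  intro E; assert (H := surplus_spec (Snoc z c) Nil).
  rewrite traversal_odd in H by (cbn [len]; now rewrite !odd_S, E).
  cbn [pairs len] in H.
  rewrite (surplus_spec (pairs z)), (surplus_spec c), (traversal_even z c E),
    (surplus_spec (pairs z)) in H; lia.
Qed.

(** What [t] contributes to the surplus when more elements follow
    ([surplus_Snoc]); the added [Nil] contributes nothing itself. *)
Definition delay (t : bin) : nat := surplus (Snoc t Nil).

Lemma delay_odd t : Nat.odd (len t) = true -> delay t = 1.
Proof. intro E; unfold delay; now rewrite surplus_even. Qed.

Lemma delay_Nil : delay Nil = 1.
Proof. reflexivity. Qed.

(** With a further element [v] at the end, the list ends with [v] preceded by an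
    element that has [u] at its own end.  When [v] is appended to that element is
    decided by parities that depend on [t] only; once everything in front of [u]
    is gone, the steps that remain are those of [u] followed by [v]. *)
Lemma surplus_Snoc t u : surplus (Snoc t u) = delay t + surplus u.
Proof.
  enough (exists k, forall u, surplus (Snoc t u) = k + surplus u) as [k Hk].
  { unfold delay; rewrite !Hk, surplus_Nil; lia. }
  clear u; induction t as [t IH] using bin_weight_ind.
  destruct (Nat.odd (len t)) eqn:E.
  - exists 1; intro u; now apply surplus_even.
  - destruct t as [|z c].
    { exists 1; intro u; rewrite surplus_odd; reflexivity. }
    cbn [len] in E; rewrite odd_S, negb_false_iff in E.
    assert (W := weight_pairs z E).
    destruct (IH (pairs z)) as [k1 H1]; [cbn [weight]; lia|].
    destruct (IH c) as [k2 H2]; [cbn [weight]; lia|].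
    exists (S (k1 + k2)); intro u.
    rewrite surplus_odd by (cbn [len]; now rewrite !odd_S, E).
    cbn [pairs]; rewrite H1, H2; lia.
Qed.

(** An even list followed by two elements has even length: the next step pairs
    [c] with the element behind it, and [pairs z] and [c] are processed in turn. *)
Lemma delay_even z c :
  Nat.odd (len z) = true -> delay (Snoc z c) = S (delay (pairs z) + delay c).
Proof.
  intro E; unfold delay at 1.
  rewrite surplus_odd by (cbn [len]; now rewrite !odd_S, E).
  cbn [pairs]; rewrite !surplus_Snoc, surplus_Nil; lia.
Qed.

Fixpoint full (n : nat) : bin :=
  match n with 0 => Nil | S n => Snoc (full n) (full n) end.

Lemma traversal_full n :
  traversal (full (S n)) = 2 * traversal (full n) + surplus (full n) + 1.
Proof. cbn [full]; rewrite surplus_spec; lia. Qed.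

Lemma surplus_full n : surplus (full (S n)) = delay (full n) + surplus (full n).
Proof. apply surplus_Snoc. Qed.

(** * Surviving rounds and congruences *)

(** The trivial bound, used for what is left after many rounds. *)
Lemma delay_le_weight t : delay t <= S (weight t).
Proof.
  induction t as [t IH] using bin_weight_ind.
  destruct (Nat.odd (len t)) eqn:E; [rewrite delay_odd by exact E; lia|].
  destruct t as [|z c]; [apply Nat.le_refl|].
  cbn [len] in E; rewrite odd_S, negb_false_iff in E.
  assert (W := weight_pairs z E).
  rewrite delay_even by exact E; cbn [weight] in *.
  assert (H1 := IH (pairs z) ltac:(lia)); assert (H2 := IH c ltac:(lia)); lia.
Qed.

Definition rest (t : bin) : bin :=
  match t with Nil => Nil | Snoc z _ => pairs z end.

Definition final (t : bin) : bin :=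
  match t with Nil => Nil | Snoc _ c => c end.

Fixpoint stage (j : nat) (t : bin) : bin :=
  match j with 0 => t | S j => stage j (rest t) end.

(** [live j t]: the recursion for [delay t] follows [rest] for at least [j]
    rounds. *)
Fixpoint live (j : nat) (t : bin) : Prop :=
  match j with
  | 0 => True
  | S j => t <> Nil /\ Nat.odd (len t) = false /\ live j (rest t)
  end.

Lemma live_S_inv j t : live (S j) t ->
  exists z c, t = Snoc z c /\ Nat.odd (len z) = true /\ live j (pairs z).
Proof.
  intros (Hn & He & Hl); destruct t as [|z c]; [easy|].
  exists z, c; cbn [len] in He; rewrite odd_S, negb_false_iff in He; auto.
Qed.

Lemma live_le i j t : i <= j -> live j t -> live i t.
Proof.
  revert j t; induction i as [|i IH]; [easy|].
  intros [|j] t Hij; [lia|]; intros (Hn & He & Hl).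
  repeat split; auto; apply (IH j); auto; lia.
Qed.

Lemma live_stage j t : live j t -> live 1 (stage j t) -> live (S j) t.
Proof.
  revert t; induction j as [|j IH]; intros t; [auto|].
  intros (Hn & He & Hl) H; exact (conj Hn (conj He (IH _ Hl H))).
Qed.

Lemma stage_live j t : live (S j) t -> live 1 (stage j t).
Proof.
  revert t; induction j as [|j IH]; intros t.
  - intros (Hn & He & _); repeat split; auto.
  - intros (_ & _ & Hl); exact (IH _ Hl).
Qed.

Lemma stage_S j t : stage (S j) t = rest (stage j t).
Proof. revert t; induction j as [|j IH]; intro t; [reflexivity | apply IH]. Qed.

Lemma delay_live t : live 1 t -> delay t = S (delay (rest t) + delay (final t)).
Proof.
  intros H; apply live_S_inv in H as (z & c & -> & E & _); now apply delay_even.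
Qed.

Lemma live_or_delay_1 t : live 1 t \/ (~ live 1 t /\ delay t = 1).
Proof.
  destruct (Nat.odd (len t)) eqn:E.
  - right; split; [intros (_ & E' & _); congruence | now apply delay_odd].
  - destruct t as [|z c]; [|left; repeat split; easy].
    right; split; [now intros [] | reflexivity].
Qed.

Inductive extends (p : bin) : nat -> bin -> Prop :=
| extends_0 : extends p 0 p
| extends_S d t c : extends p d t -> extends p (S d) (Snoc t c).

Lemma len_extends p d t : extends p d t -> len t = d + len p.
Proof. induction 1; cbn [len]; lia. Qed.

Lemma extends_S_inv p d z c : extends p (S d) (Snoc z c) -> extends p d z.
Proof. now inversion 1. Qed.

(** Pairing starts from the bottom, so it commutes with cutting off an even
    number of elements at the end. *)
Lemma extends_pairs p d t : extends p (2 * d) t -> 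
  extends (pairs p) d (pairs t).
Proof.
  revert t; induction d as [|d IH]; intros t H.
  - inversion H; constructor.
  - replace (2 * S d) with (S (S (2 * d))) in H by lia.
    inversion H as [|? u c2 H1]; subst; inversion H1 as [|? v c1 H2]; subst.
    cbn [pairs]; constructor; auto.
Qed.

Lemma extends_rest p d t : Nat.odd (len p) = true -> live 1 t ->
  extends p d t -> exists e, d = S (2 * e) /\ extends (pairs p) e (rest t).
Proof.
  intros Hp Ht H; apply live_S_inv in Ht as (z & c & -> & E & _).
  inversion H as [|d' ? ? H']; subst.
  - cbn [len] in Hp; now rewrite odd_S, E in Hp.
  - rewrite (len_extends _ _ _ H'), Nat.odd_add, Hp in E.
    assert (Ev : Nat.Even d').
    { apply Nat.even_spec; rewrite <- Nat.negb_odd.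
      now destruct (Nat.odd d'). }
    destruct Ev as [e ->]; exists e; split; [reflexivity|].
    now apply extends_pairs.
Qed.

Lemma extends_shift p c d t : extends (Snoc p c) d t -> extends p (S d) t.
Proof. induction 1; repeat constructor; assumption. Qed.

(** One round turns the common beginning [p] into a common beginning and halves
    the numbers of further elements, which must have the same parity for both
    lists to have even length.  A round uses up at most half of [p] and one
    element more, hence the condition on [len p]. *)
Lemma live_congruent j p d d' t t' : 2 ^ j <= S (len p) ->
  extends p d t -> extends p d' t' -> live j t -> live j t' ->
  (Z.of_nat (2 ^ j) | Z.of_nat d - Z.of_nat d')%Z.
Proof.
  revert p d d' t t'; induction j as [|j IH]; intros p d d' t t' Hp H H' L L'.
  { exists (Z.of_nat d - Z.of_nat d')%Z; simpl; lia. }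
  assert (Hodd : forall p d d', 2 ^ S j <= S (len p) -> Nat.odd (len p) = true ->
    extends p d t -> extends p d' t' ->
    (Z.of_nat (2 ^ S j) | Z.of_nat d - Z.of_nat d')%Z).
  { clear p d d' Hp H H'; intros p d d' Hp Op H H'.
    destruct (extends_rest p d t) as (e & -> & He); auto.
    { apply (live_le 1 (S j)); [lia | assumption]. }
    destruct (extends_rest p d' t') as (e' & -> & He'); auto.
    { apply (live_le 1 (S j)); [lia | assumption]. }
    destruct L as (_ & _ & L), L' as (_ & _ & L').
    rewrite Nat.pow_succ_r' in Hp |- *.
    assert (Hl := len_pairs_ge p).
    destruct (IH (pairs p) e e' (rest t) (rest t')) as [k Hk]; auto; [lia|].
    exists k; lia. }
  destruct (Nat.odd (len p)) eqn:Op; [now apply (Hodd p)|].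
  destruct p as [|p c].
  { cbn [len] in Hp; rewrite Nat.pow_succ_r' in Hp.
    assert (2 ^ j <> 0) by (apply Nat.pow_nonzero; lia); lia. }
  replace (Z.of_nat d - Z.of_nat d')%Z with (Z.of_nat (S d) - Z.of_nat (S d'))%Z by lia.
  cbn [len] in *; rewrite odd_S, negb_false_iff in Op.
  apply (Hodd p); eauto using extends_shift.
  assert (Ho : Nat.Odd (len p)) by now apply Nat.odd_spec.
  destruct Ho as [m Hm]; rewrite Nat.pow_succ_r' in *; lia.
Qed.

(** Each round removes the last element and merges the others, so [j] rounds use
    up the last [2 ^ j - 1] elements exactly, and what remains comes from [p]. *)
Lemma weight_stage j p t : extends p (2 ^ j - 1) t -> live j t ->
  weight (stage j t) <= weight p.
Proof.
  revert p t; induction j as [|j IH]; intros p t H L.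
  - simpl in H; inversion H; apply Nat.le_refl.
  - apply live_S_inv in L as (z & c & -> & E & L).
    assert (Hj : 2 ^ j <> 0) by (apply Nat.pow_nonzero; lia).
    replace (2 ^ S j - 1) with (S (2 * (2 ^ j - 1))) in H
      by (rewrite Nat.pow_succ_r'; lia).
    apply extends_S_inv in H as H'.
    rewrite (len_extends _ _ _ H'), (Nat.add_comm _ (len p)) in E.
    rewrite Nat.odd_add_mul_2 in E.
    apply extends_pairs, IH in H'; [|exact L].
    apply weight_pairs in E; cbn [stage rest]; lia.
Qed.

(** * Lists built on a common beginning *)

(** [based p w t]: [t] is a binary tree with copies of [p] in the place of
    leaves, and [w] is its number of nodes, each copy of [p] counting as one. *)
Inductive based (p : bin) : nat -> bin -> Prop :=
| based_base : based p 1 p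
| based_Snoc w1 w2 l c :
    based p w1 l -> based p w2 c -> based p (S (w1 + w2)) (Snoc l c).

(** [top_based p d v t]: the last [d] elements of [t] are based on [p] and have
    [v] nodes in all, including the spine nodes; nothing is said of the elements
    before them.  Unlike [based], this survives [pairs]. *)
Inductive top_based (p : bin) : nat -> nat -> bin -> Prop :=
| top_based_0 t : top_based p 0 0 t
| top_based_S d v w l c : top_based p d v l -> based p w c ->
    top_based p (S d) (S (v + w)) (Snoc l c).

Lemma top_based_S_inv p d v z c : top_based p (S d) v (Snoc z c) ->
  exists v0 w, v = S (v0 + w) /\ top_based p d v0 z /\ based p w c.
Proof. inversion 1; subst; eauto 6. Qed.

Lemma based_top p w t : based p w t ->
  exists d v, w = S v /\ extends p d t /\ top_based p d v t.
Proof.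
  induction 1 as [|w1 w2 l c _ (d & v & -> & H1 & H2) Hc _].
  - exists 0, 0; repeat split; constructor.
  - exists (S d), (S (v + w2)); repeat split; constructor; auto.
Qed.

(** If [d] is odd, one based element is merged with something unknown and is
    given up. *)
Lemma top_based_pairs p d v t : top_based p d v t ->
  exists v', v' <= v /\ top_based p (d / 2) v' (pairs t).
Proof.
  revert v t; induction d as [d IH] using lt_wf_ind; intros v t H.
  destruct d as [|[|d]]; [exists 0 | exists 0 |].
  - split; [lia | constructor].
  - split; [lia | constructor].
  - inversion H as [|? v1 w2 u c2 H1 Hc2]; subst.
    inversion H1 as [|? v0 w1 l c1 H0 Hc1]; subst.
    destruct (IH d ltac:(lia) _ _ H0) as (v' & Hv & H').
    exists (S (v' + S (w1 + w2))); split; [lia|].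
    replace (S (S d)) with (d + 1 * 2) by lia.
    rewrite Nat.div_add, Nat.add_1_r by lia; cbn [pairs].
    repeat constructor; auto.
Qed.

Lemma top_based_stage p q v t : live (S q) t ->
  top_based p (2 ^ S q - 1) v t -> exists w, based p w (final (stage q t)).
Proof.
  revert v t; induction q as [|q IH]; intros v t L H.
  - inversion H; subst; eauto.
  - assert (Hq : 2 ^ S q <> 0) by (apply Nat.pow_nonzero; lia).
    replace (2 ^ S (S q) - 1) with (S (2 * (2 ^ S q - 1))) in H
      by (rewrite (Nat.pow_succ_r' 2 (S q)); lia).
    apply live_S_inv in L as (z & c & -> & _ & L).
    apply top_based_S_inv in H as (v0 & w & _ & H0 & _).
    apply top_based_pairs in H0 as (v' & _ & H').
    rewrite Nat.mul_comm, Nat.div_mul in H' by lia.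
    exact (IH _ _ L H').
Qed.

(** Merging adds one level at most, and a round first strips the outermost node
    off the tree, which makes up for it. *)
Lemma levels_stage j t : live j t -> levels (stage j t) <= levels t.
Proof.
  revert t; induction j as [|j IH]; intros t L; [apply Nat.le_refl|].
  apply live_S_inv in L as (z & c & -> & _ & L).
  assert (H := IH _ L); assert (H' := levels_pairs z).
  cbn [stage rest levels]; lia.
Qed.

Lemma based_levels p w t : based p w t ->
  levels p <= levels t /\ S w <= 2 ^ S (levels t - levels p).
Proof.
  induction 1 as [|w1 w2 l c _ [H1 H1'] _ [H2 H2']].
  - rewrite Nat.sub_diag; cbn; lia.
  - cbn [levels]; split; [lia|].
    set (m := Nat.max (levels l) (levels c)).
    replace (S m - levels p) with (S (m - levels p)) by lia.
    rewrite (Nat.pow_succ_r' 2 (S (m - levels p))).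
    assert (2 ^ S (levels l - levels p) <= 2 ^ S (m - levels p))
      by (apply Nat.pow_le_mono_r; lia).
    assert (2 ^ S (levels c - levels p) <= 2 ^ S (m - levels p))
      by (apply Nat.pow_le_mono_r; lia).
    lia.
Qed.

(** [short_lived p h]: lists based on [p] and of height at most [h] are too
    short-lived for the recursion of [delay] to reach their beginning [p], since
    [i] rounds consume at most [2 ^ i - 1] elements. *)
Definition short_lived (p : bin) (h : nat) : Prop :=
  forall w t i d, based p w t -> levels t <= h -> extends p d t -> live i t ->
  2 ^ i <= S d.

(** The condition [2 ^ i <= S d] is inherited by [pairs l], where [d] is halved
    along with the number of rounds; detached elements are based on [p] and not
    higher than [t], so [short_lived] applies to them afresh.  Every step of the
    recursion consumes a node. *)
Lemma delay_top_based p h v t d : short_lived p h ->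
  top_based p d v t -> levels t <= h ->
  (forall i, live i t -> 2 ^ i <= S d) -> delay t <= S v.
Proof.
  intro short.
  revert t d; induction v as [v IH] using lt_wf_ind; intros t d H Ht L.
  destruct (live_or_delay_1 t) as [L1|[_ E]]; [|lia].
  assert (Hd := L _ L1); simpl in Hd.
  inversion H as [|d' v' w l c Hl Hc]; subst; [lia|].
  rewrite (delay_live _ L1); cbn [rest final levels] in *.
  assert (Hv := levels_pairs l).
  destruct (top_based_pairs _ _ _ _ Hl) as (v1 & Hv1 & H1).
  assert (D1 : delay (pairs l) <= S v1).
  { apply (IH v1 ltac:(lia) _ _ H1); [lia|].
    intros i Li; specialize (L (S i)).
    destruct L1 as (N & O & _); specialize (L (conj N (conj O Li))).
    rewrite Nat.pow_succ_r' in L.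
    assert (Hdm := Nat.div_mod d' 2); assert (Hm := Nat.mod_upper_bound d' 2); lia. }
  destruct (based_top _ _ _ Hc) as (d2 & v2 & -> & E2 & H2).
  assert (D2 : delay c <= S v2).
  { apply (IH v2 ltac:(lia) _ _ H2); [lia|].
    intros i Li; apply (short _ _ _ _ Hc); auto; lia. }
  lia.
Qed.

Lemma delay_based p h w t : short_lived p h ->
  based p w t -> levels t <= h -> delay t <= w.
Proof.
  intros short H Ht; destruct (based_top _ _ _ H) as (d & v & -> & E & Hv).
  apply (delay_top_based p h v t d short Hv Ht).
  intros i; now apply (short _ _ _ _ H).
Qed.

(** * Bounds on the delay of full trees *)

Lemma len_full n : len (full n) = n.
Proof. induction n; cbn [full len]; congruence. Qed.

Lemma levels_full n : levels (full n) = n.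
Proof. induction n; cbn [full levels]; lia. Qed.

Lemma weight_full n : S (weight (full n)) = 2 ^ n.
Proof. induction n as [|n IH]; [reflexivity|]; cbn [full weight]; rewrite Nat.pow_succ_r'; lia. Qed.

Lemma extends_full m n : extends (full m) n (full (n + m)).
Proof. induction n; cbn [full Nat.add]; constructor; assumption. Qed.

Lemma based_full m n : exists w, based (full m) w (full (n + m)).
Proof.
  induction n as [|n [w IH]]; [exists 1; constructor|].
  exists (S (w + w)); now constructor.
Qed.

(** With [m = n - 2 ^ (q + 1) + 1], the element detached in round [q] and those
    detached while it is processed are based on [full m] and have height at most
    [n - 1].  If such a list, of length [d + m], survives [i] rounds, comparing it
    with [full n] shows that [d + 1] is divisible by [2 ^ i] as long as
    [i <= q + 1]; and [i = q + 1] would make it longer than its height allows. *)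
Lemma delay_final_stage n q : 2 ^ S (S q) <= n + 2 -> live (S q) (full n) ->
  delay (final (stage q (full n))) <= 2 ^ (2 ^ S q - 1).
Proof.
  intros Hn L; set (N := 2 ^ S q) in *.
  assert (HN : 2 * N <= n + 2) by (rewrite (Nat.pow_succ_r' 2 (S q)) in Hn; exact Hn).
  assert (HN0 : 2 <= N) by (apply (Nat.pow_le_mono_r 2 1); lia).
  set (m := S (n - N)); replace n with (N - 1 + m) in L |- * by lia.
  assert (Hr := extends_full m (N - 1)).
  destruct (based_full m (N - 1)) as [w0 Hw0].
  destruct (based_top _ _ _ Hw0) as (d & v & _ & Ed & Hv).
  replace d with (2 ^ S q - 1) in Hv.
  2: { apply len_extends in Ed, Hr; fold N; lia. }
  destruct (top_based_stage _ _ _ _ L Hv) as [w Hw].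
  assert (Hlev : levels (final (stage q (full (N - 1 + m)))) <= N - 2 + m).
  { assert (H := levels_stage q _ (live_le q (S q) _ ltac:(lia) L)).
    rewrite levels_full in H.
    destruct (live_S_inv _ _ (stage_live _ _ L)) as (z & c & E & _ & _).
    rewrite E in H |- *; cbn [final levels] in *; lia. }
  assert (Hshort : short_lived (full m) (N - 2 + m)).
  { clear w Hw w0 Hw0 d v Ed Hv; intros w t i d _ Ht Hd Li.
    assert (Hl := len_extends _ _ _ Hd); rewrite len_full in Hl.
    assert (Hl' := len_le_levels t).
    set (k := Nat.min i (S q)).
    assert (Hk : 2 ^ k <= N) by (apply Nat.pow_le_mono_r; lia).
    assert (C : (Z.of_nat (2 ^ k) | Z.of_nat d - Z.of_nat (N - 1))%Z).
    { apply (live_congruent k (full m) d (N - 1) t (full (N - 1 + m))); auto.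
      - rewrite len_full; lia.
      - apply (live_le k i); [lia | assumption].
      - apply (live_le k (S q)); [lia | assumption]. }
    assert (D : (Z.of_nat (2 ^ k) | Z.of_nat (S d))%Z).
    { replace (Z.of_nat (S d))
        with (Z.of_nat d - Z.of_nat (N - 1) + Z.of_nat N)%Z by lia.
      apply Z.divide_add_r; [exact C|].
      exists (Z.of_nat (2 ^ (S q - k))); rewrite <- Nat2Z.inj_mul, <- Nat.pow_add_r.
      unfold N; do 2 f_equal; lia. }
    apply Z.divide_pos_le in D; [|lia].
    destruct (Nat.le_gt_cases i (S q)).
    - replace k with i in D by lia; lia.
    - replace k with (S q) in D by lia; fold N in D; lia. }
  assert (D := delay_based (full m) (N - 2 + m) _ _ Hshort Hw Hlev).
  destruct (based_levels _ _ _ Hw) as [_ H].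
  rewrite levels_full in H.
  assert (2 ^ S (levels (final (stage q (full (N - 1 + m)))) - m) <= 2 ^ (N - 1))
    by (apply Nat.pow_le_mono_r; lia).
  lia.
Qed.

(** Sums the contributions of the detached elements; they grow doubly
    exponentially with the round, so the last one dominates. *)
Lemma delay_full_stage n k : 2 ^ S k <= n + 2 ->
  (~ live k (full n) /\ delay (full n) <= 2 ^ S (2 ^ k)) \/
  (live k (full n) /\ S (delay (full n)) <= 2 ^ S (2 ^ k) + delay (stage k (full n))).
Proof.
  induction k as [|k IH]; intros Hn.
  { right; split; [exact I|]; cbn [stage]; simpl; lia. }
  assert (Hp : 2 ^ S (2 ^ k) <= 2 * 2 ^ (2 ^ S k - 1) /\
    2 ^ S (2 ^ S k) = 4 * 2 ^ (2 ^ S k - 1) /\ 2 ^ (2 ^ S k - 1) <> 0).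
  { assert (2 ^ k <> 0) by (apply Nat.pow_nonzero; lia).
    rewrite (Nat.pow_succ_r' 2 k); repeat split.
    - rewrite <- (Nat.pow_succ_r' 2 (_ - _)); apply Nat.pow_le_mono_r; lia.
    - replace (S (2 * 2 ^ k)) with (S (S (2 * 2 ^ k - 1))) by lia.
      rewrite !Nat.pow_succ_r'; lia.
    - apply Nat.pow_nonzero; lia. }
  destruct Hp as (P1 & P2 & P3).
  destruct IH as [[NL D]|[L D]].
  { rewrite (Nat.pow_succ_r' 2 (S k)) in Hn; lia. }
  - left; split; [|lia].
    intro L; apply NL, (live_le k (S k)); [lia | assumption].
  - destruct (live_or_delay_1 (stage k (full n))) as [L1|[N E]].
    + right; assert (L' := live_stage _ _ L L1); split; [exact L'|].
      assert (F := delay_final_stage n k Hn L').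
      rewrite (delay_live _ L1), <- stage_S in D; lia.
    + left; split; [|lia].
      intro L'; exact (N (stage_live _ _ L')).
Qed.

(** Follows the recursion for the largest number [k] of rounds that
    [delay_full_stage] allows.  Then [2 ^ k] is between [n / 4] and [n / 2], up to
    constants: the detached elements contribute about [2 ^ (n / 2)], and at least
    a quarter of the levels is gone from what remains after [k] rounds. *)
Lemma delay_full_bound n : 8 <= n -> delay (full n) <= 2 ^ S (n - n / 4).
Proof.
  intro Hn.
  assert (exists k, 2 ^ S k <= n + 2 < 2 ^ S (S k)) as (k & K1 & K2).
  { exists (pred (Nat.log2 (n + 2))).
    assert (H := Nat.log2_spec (n + 2) ltac:(lia)).
    assert (1 <= Nat.log2 (n + 2)) by (apply (Nat.log2_le_mono 2); lia).
    now replace (S (pred (Nat.log2 (n + 2)))) with (Nat.log2 (n + 2)) by lia. }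
  rewrite !Nat.pow_succ_r' in K2.
  assert (Hdm := Nat.div_mod n 4 ltac:(lia)).
  assert (Hm := Nat.mod_upper_bound n 4 ltac:(lia)).
  assert (K1' := K1); rewrite Nat.pow_succ_r' in K1'.
  assert (B1 : 2 ^ S (2 ^ k) <= 2 ^ (n - n / 4)) by (apply Nat.pow_le_mono_r; lia).
  rewrite Nat.pow_succ_r'.
  destruct (delay_full_stage n k K1) as [[_ D]|[L D]]; [lia|].
  enough (delay (stage k (full n)) <= 2 ^ (n - n / 4)) by lia.
  etransitivity; [apply delay_le_weight|].
  assert (E := extends_full (n - (2 ^ k - 1)) (2 ^ k - 1)).
  replace (2 ^ k - 1 + (n - (2 ^ k - 1))) with n in E by lia.
  assert (W := weight_stage _ _ _ E L).
  assert (W' := weight_full (n - (2 ^ k - 1))).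
  assert (2 ^ (n - (2 ^ k - 1)) <= 2 ^ (n - n / 4)) by (apply Nat.pow_le_mono_r; lia).
  lia.
Qed.

(** * Splaying and nested lists *)

Fixpoint bare {A} (t : tree A) : bin :=
  match t with Empty => Nil | Node l _ r => Snoc (bare l) (bare r) end.

Lemma list_pair_ind A (P : list A -> Prop) :
  P [] -> (forall a, P [a]) -> (forall a b l, P l -> P (a :: b :: l)) ->
  forall l, P l.
Proof.
  intros H0 H1 H2 l.
  enough (P l /\ forall a, P (a :: l)) by tauto.
  induction l as [|b l [IH IH']]; auto.
Qed.

(** The spine nodes above the leftmost node are kept as pairs of a label and a
    right subtree, parent first. *)
Definition left_frames (fs : list (nat * tree nat)) : list (frame nat) :=
  map (fun f => LeftOf (fst f) (snd f)) fs.

Fixpoint plug (fs : list (nat * tree nat)) (t : tree nat) : tree nat :=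
  match fs with
  | [] => t
  | (p, c) :: fs => plug fs (Node t p c)
  end.

(** What splaying the leftmost node through the spine nodes [fs] makes of its
    right subtree [t]. *)
Fixpoint regroup (fs : list (nat * tree nat)) (t : tree nat) : tree nat :=
  match fs with
  | [] => t
  | [(p, c)] => Node t p c
  | (p, c) :: (g, d) :: fs => regroup fs (Node t p (Node c g d))
  end.

Lemma splay_up_root fs x b :
  splay_up (left_frames fs) (Node Empty x b)
  = (Node Empty x (regroup fs b), length fs).
Proof.
  revert b; induction fs as [|[p c]|[p c] [g d] fs IH] using list_pair_ind;
    intro b; [reflexivity..|].
  cbn [left_frames map fst snd splay_up rotate_right].
  fold (left_frames fs); now rewrite IH.
Qed.

(** The root [y] above the spine changes the last step only, from nothing to a zig
    or from a zig to a zigzag, and ends up on the left of [x]. *)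
Lemma splay_up_right fs l y x b :
  splay_up (left_frames fs ++ [RightOf l y]) (Node Empty x b)
  = (Node (Node l y Empty) x (regroup fs b), S (length fs)).
Proof.
  revert b; induction fs as [|[p c]|[p c] [g d] fs IH] using list_pair_ind;
    intro b; [reflexivity..|].
  cbn [left_frames map fst snd app splay_up rotate_right].
  fold (left_frames fs); now rewrite IH.
Qed.

Lemma bare_regroup fs t b : Nat.odd (len (bare t)) = true ->
  bare b = pairs (bare t) -> bare (regroup fs b) = shrink (bare (plug fs t)).
Proof.
  revert t b; induction fs as [|[p c]|[p c] [g d] fs IH] using list_pair_ind;
    intros t b O E; cbn [plug regroup].
  - unfold shrink; now rewrite O.
  - unfold shrink; cbn [bare len]; now rewrite odd_S, O, E.
  - apply IH; cbn [bare len pairs]; [now rewrite !odd_S, O | now rewrite E].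
Qed.

Lemma len_plug fs t : len (bare (plug fs t)) = length fs + len (bare t).
Proof.
  revert t; induction fs as [|[p c] fs IH]; intro t; [reflexivity|].
  cbn [plug]; rewrite IH; cbn [bare len length]; lia.
Qed.

Lemma plug_snoc fs p c t : plug (fs ++ [(p, c)]) t = Node (plug fs t) p c.
Proof. revert t; induction fs as [|[q d] fs IH]; intro t; [reflexivity | apply IH]. Qed.

Lemma plug_leftmost l y r : exists fs x b, Node l y r = plug fs (Node Empty x b).
Proof.
  revert y r; induction l as [|l IH z s _]; intros y r.
  - now exists [], y, r.
  - destruct (IH z s) as (fs & x & b & ->).
    exists (fs ++ [(y, r)]), x, b; now rewrite plug_snoc.
Qed.

Definition inorder_frames (fs : list (nat * tree nat)) : list nat :=
  flat_map (fun f => fst f :: inorder (snd f)) fs.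

Lemma inorder_plug fs t : inorder (plug fs t) = inorder t ++ inorder_frames fs.
Proof.
  revert t; induction fs as [|[p c] fs IH]; intro t; [now rewrite app_nil_r|].
  cbn [plug]; rewrite IH; cbn [inorder]; now rewrite <- app_assoc.
Qed.

Lemma inorder_regroup fs t :
  inorder (regroup fs t) = inorder t ++ inorder_frames fs.
Proof.
  revert t; induction fs as [|[p c]|[p c] [g d] fs IH] using list_pair_ind;
    intro t; cbn [regroup].
  - now rewrite app_nil_r.
  - cbn [inorder inorder_frames flat_map fst snd]; now rewrite app_nil_r.
  - rewrite IH; unfold inorder_frames; cbn [inorder flat_map fst snd].
    now rewrite <- !app_assoc; cbn [app]; rewrite <- !app_assoc.
Qed.

Lemma locate_none x t k : ~ In x (inorder t) -> locate x t k = None.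
Proof.
  revert k; induction t as [|l IHl y r IHr]; intros k H; [reflexivity|].
  cbn [inorder] in H; rewrite in_app_iff in H; cbn [In] in H; cbn [locate].
  destruct (Nat.eqb_spec x y); [subst; tauto|].
  rewrite IHl, IHr; tauto.
Qed.

Lemma locate_leftmost x b fs k : ~ In x (inorder_frames fs) ->
  locate x (plug fs (Node Empty x b)) k
  = Some (left_frames fs ++ k, Node Empty x b).
Proof.
  revert k; induction fs as [|[p c] fs IH] using rev_ind; intros k H.
  - cbn [plug locate left_frames map app]; now rewrite Nat.eqb_refl.
  - unfold inorder_frames in H; rewrite flat_map_app, in_app_iff in H.
    cbn [flat_map fst snd app In] in H.
    rewrite plug_snoc; cbn [locate].
    destruct (Nat.eqb_spec x p); [subst; tauto|].
    rewrite IH by (unfold inorder_frames; tauto).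
    unfold left_frames; now rewrite map_app, <- app_assoc.
Qed.

Lemma traversal_plug fs x b :
  traversal (bare (plug fs (Node Empty x b)))
  = S (length fs) + traversal (bare (regroup fs b)).
Proof.
  rewrite traversal_step, <- (bare_regroup fs (Node Empty x b) b eq_refl eq_refl).
  rewrite len_plug; cbn [bare len]; lia.
Qed.

(** The left subtree [l] of the root is arbitrary: no node of it is visited any
    more. *)
Lemma splay_all_right r l y : NoDup (inorder (Node l y r)) ->
  splay_all (inorder r) (Node l y r) = traversal (bare r).
Proof.
  remember (length (inorder r)) as n eqn:En.
  revert r l y En; induction n as [|n IH]; intros [|l' y' r'] l y En N.
  - reflexivity.
  - cbn [inorder] in En; rewrite length_app in En; cbn [length] in En; lia.
  - discriminate.
  - destruct (plug_leftmost l' y' r') as (fs & x & b & E).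
    rewrite E, inorder_plug, traversal_plug in *; clear l' y' r' E.
    cbn [inorder app length] in *.
    assert (Nx : ~ In x (inorder l) /\ x <> y /\ ~ In x (inorder_frames fs)).
    { rewrite inorder_plug in N; cbn [inorder app] in N.
      change (y :: x :: ?u) with ([y] ++ x :: u) in N.
      rewrite app_assoc in N.
      apply NoDup_remove_2 in N; rewrite !in_app_iff in N; cbn [In] in N.
      intuition. }
    destruct Nx as (N1 & N2 & N3).
    cbn [splay_all]; unfold splay; cbn [locate].
    destruct (Nat.eqb_spec x y); [easy|].
    rewrite locate_none, locate_leftmost, splay_up_right by assumption.
    rewrite <- inorder_regroup.
    rewrite IH; [reflexivity| |].
    + rewrite inorder_regroup; lia.
    + rewrite inorder_plug in N; cbn [inorder app] in *.
      now rewrite inorder_regroup, <- app_assoc.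
Qed.

Lemma bare_name {A} (t : tree A) k : bare (name k t) = bare t.
Proof.
  revert k; induction t as [|l IHl x r IHr]; intro k; [reflexivity|].
  cbn [name bare]; now rewrite IHl, IHr.
Qed.

(** The first splay starts without a root above the spine and so takes one
    rotation less than the length of the list. *)
Lemma cost_traversal A (l : tree A) a r :
  S (cost (Node l a r)) = traversal (bare (Node l a r)).
Proof.
  rewrite <- (bare_name (Node l a r) 0); unfold cost.
  assert (N : NoDup (inorder (name 0 (Node l a r))))
    by (rewrite inorder_name; apply seq_NoDup).
  cbn [name] in *.
  destruct (plug_leftmost (name 0 l) (0 + size l) (name (S (0 + size l)) r))
    as (fs & x & b & E).
  rewrite E, traversal_plug in *; clear E.
  rewrite inorder_plug in *; cbn [inorder app splay_all] in *.
  apply NoDup_cons_iff in N as N'; destruct N' as [Nx _].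
  rewrite in_app_iff in Nx.
  unfold splay; rewrite locate_leftmost by tauto.
  rewrite app_nil_r, splay_up_root, <- inorder_regroup.
  rewrite splay_all_right; [lia|].
  cbn [inorder app]; now rewrite inorder_regroup.
Qed.

Lemma bare_maximal h : bare (maximal h) = full (S h).
Proof.
  induction h as [|h IH]; [reflexivity|].
  cbn [maximal bare]; now rewrite IH.
Qed.

Lemma cost_maximal h : S (cost (maximal h)) = traversal (full (S h)).
Proof.
  rewrite <- bare_maximal; destruct h; apply cost_traversal.
Qed.

(** * The limit as a series *)

Open Scope R_scope.

(** The summand [surplus + 1] is what [mean] still gains when it is continued to
    infinity with a constant surplus; with it included, each term of the series
    is given by a single [delay]. *)
Definition approx (n : nat) : R :=
  (INR (traversal (full n)) + INR (surplus (full n)) + 1) / 2 ^ n.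

Definition mean (n : nat) : R := INR (traversal (full n)) / 2 ^ n.

Lemma pow2_pos n : 0 < 2 ^ n.
Proof. apply pow_lt; lra. Qed.

Lemma approx_0 : approx 0 = 1.
Proof. unfold approx; simpl; lra. Qed.

Lemma approx_S n : approx (S n) = approx n + INR (delay (full n)) / 2 ^ S n.
Proof.
  unfold approx; rewrite traversal_full, surplus_full, !plus_INR, mult_INR.
  rewrite <- tech_pow_Rmult; simpl (INR 2); simpl (INR 1).
  field; apply Rgt_not_eq, pow2_pos.
Qed.

Lemma approx_growing : Un_growing approx.
Proof.
  intro n; rewrite approx_S.
  assert (0 <= INR (delay (full n)) / 2 ^ S n); [|lra].
  apply Rmult_le_pos; [apply pos_INR|].
  apply Rlt_le, Rinv_0_lt_compat, pow2_pos.
Qed.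

Lemma INR_pow2 n : INR (2 ^ n) = 2 ^ n.
Proof. rewrite pow_INR; reflexivity. Qed.

(** The terms are compared with [2 ^ k / 2 ^ (n + 1)], a geometric series. *)
Lemma approx_le_range a b k : (a <= b)%nat ->
  (forall n, (a <= n < b)%nat -> (delay (full n) <= 2 ^ k)%nat) ->
  approx b <= approx a + 2 ^ k / 2 ^ a.
Proof.
  intros Hab H.
  enough (approx b + 2 ^ k / 2 ^ b <= approx a + 2 ^ k / 2 ^ a).
  { assert (0 < 2 ^ k / 2 ^ b) by (apply Rdiv_lt_0_compat; apply pow2_pos); lra. }
  induction Hab as [|b Hab IH]; [lra|].
  etransitivity; [|apply IH; intros; apply H; lia].
  rewrite approx_S; assert (D := H b ltac:(lia)).
  apply le_INR in D; rewrite INR_pow2 in D.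
  assert (INR (delay (full b)) / 2 ^ S b <= 2 ^ k / 2 ^ S b).
  { apply Rmult_le_compat_r; [|exact D].
    apply Rlt_le, Rinv_0_lt_compat, pow2_pos. }
  assert (2 ^ k / 2 ^ b = 2 * (2 ^ k / 2 ^ S b)).
  { rewrite <- (tech_pow_Rmult 2 b); field; apply Rgt_not_eq, pow2_pos. }
  lra.
Qed.

Lemma approx_S_le n j : (8 <= n)%nat -> (n / 4 = j)%nat ->
  approx (S n) <= approx n + / 2 ^ j.
Proof.
  intros Hn Hj; rewrite approx_S; apply Rplus_le_compat_l.
  assert (D := delay_full_bound n Hn); rewrite Hj in D.
  apply le_INR in D; rewrite INR_pow2 in D.
  assert (j <= n)%nat by (subst j; apply Nat.Div0.div_le_upper_bound; lia).
  replace (2 ^ S n) with (2 ^ S (n - j) * 2 ^ j)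
    by (rewrite <- pow_add; f_equal; lia).
  unfold Rdiv; rewrite Rinv_mult, <- Rmult_assoc.
  rewrite <- (Rmult_1_l (/ 2 ^ j)) at 2.
  apply Rmult_le_compat_r; [apply Rlt_le, Rinv_0_lt_compat, pow2_pos|].
  apply Rmult_le_reg_r with (2 ^ S (n - j)); [apply pow2_pos|].
  rewrite Rmult_assoc, Rinv_l by apply Rgt_not_eq, pow2_pos; lra.
Qed.

(** Four consecutive terms are at most [/ 2 ^ j] each when [n / 4 = j]. *)
Lemma approx_le_tail m n : (2 <= m)%nat -> approx n <= approx (4 * m) + 8 / 2 ^ m.
Proof.
  intro Hm.
  assert (B : forall j, approx (4 * (m + j)) + 8 / 2 ^ (m + j)
                        <= approx (4 * m) + 8 / 2 ^ m).
  { induction j as [|j IH]; [rewrite Nat.add_0_r; lra|].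
    etransitivity; [|exact IH].
    set (q := (m + j)%nat); replace (m + S j)%nat with (S q) by (unfold q; lia).
    replace (4 * S q)%nat with (S (S (S (S (4 * q))))) by lia.
    assert (Hq : forall r, (r < 4)%nat -> ((r + 4 * q) / 4 = q)%nat).
    { intros r Hr; rewrite Nat.mul_comm, Nat.div_add, Nat.div_small; lia. }
    assert (H0 := approx_S_le (4 * q) q ltac:(lia) (Hq 0%nat ltac:(lia))).
    assert (H1 := approx_S_le (S (4 * q)) q ltac:(lia) (Hq 1%nat ltac:(lia))).
    assert (H2 := approx_S_le (S (S (4 * q))) q ltac:(lia) (Hq 2%nat ltac:(lia))).
    assert (H3 := approx_S_le (S (S (S (4 * q)))) q ltac:(lia) (Hq 3%nat ltac:(lia))).
    assert (8 / 2 ^ S q = 4 * / 2 ^ q)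
      by (rewrite <- tech_pow_Rmult; field; apply Rgt_not_eq, pow2_pos).
    unfold Rdiv in *; lra. }
  specialize (B n).
  assert (0 < 8 / 2 ^ (m + n)) by (apply Rdiv_lt_0_compat; [lra | apply pow2_pos]).
  assert (approx n <= approx (4 * (m + n))); [|lra].
  apply Rge_le, growing_prop; [exact approx_growing | lia].
Qed.

Lemma approx_cv : exists alpha, Un_cv approx alpha.
Proof.
  destruct (growing_cv approx approx_growing) as [alpha H]; [|now exists alpha].
  exists (approx (4 * 2) + 8 / 2 ^ 2); intros x [n ->]; apply approx_le_tail; lia.
Qed.

Lemma mean_S n : mean (S n) = mean n + (approx n - mean n) / 2.
Proof.
  unfold mean, approx; rewrite traversal_full, !plus_INR, mult_INR.
  rewrite <- tech_pow_Rmult; simpl (INR 2); simpl (INR 1).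
  field; apply Rgt_not_eq, pow2_pos.
Qed.

Lemma Un_cv_ext u v l : (forall n, u n = v n) -> Un_cv u l -> Un_cv v l.
Proof. intros E H e He; destruct (H e He) as [N HN]; exists N; intros; rewrite <- E; auto. Qed.

Lemma Un_cv_S u l : Un_cv u l -> Un_cv (fun n => u (S n)) l.
Proof. intros H e He; destruct (H e He) as [N HN]; exists N; intros; apply HN; lia. Qed.

Lemma Un_cv_const c : Un_cv (fun _ => c) c.
Proof. intros e He; exists 0%nat; intros; now rewrite R_dist_eq. Qed.

(** [mean] is increasing and bounded by [approx], so it converges; its
    increments, which are half the differences [approx n - mean n], tend to 0. *)
Lemma mean_cv alpha : Un_cv approx alpha -> Un_cv mean alpha.
Proof.
  intro H.
  assert (Hle : forall n, mean n <= approx n).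
  { intro n; unfold mean, approx; apply Rmult_le_compat_r.
    - apply Rlt_le, Rinv_0_lt_compat, pow2_pos.
    - assert (Hs := pos_INR (surplus (full n))); lra. }
  assert (G : Un_growing mean).
  { intro n; rewrite mean_S; specialize (Hle n); lra. }
  destruct (growing_cv mean G) as [l Hl].
  { exists alpha; intros x [n ->]; etransitivity; [apply Hle|].
    apply (growing_ineq approx); [exact approx_growing | exact H]. }
  assert (E : Un_cv approx (2 * (l - l) + l)).
  { apply (Un_cv_ext (fun n => 2 * (mean (S n) - mean n) + mean n)).
    - intro n; rewrite mean_S; lra.
    - apply CV_plus; [|exact Hl].
      apply CV_mult; [apply Un_cv_const|].
      apply CV_minus; [now apply Un_cv_S | exact Hl]. }
  replace alpha with l; [exact Hl|].
  rewrite (UL_sequence _ _ _ H E); lra.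
Qed.

(** Both the first splay and the number of nodes fall short by one, which
    accounts for the correction term. *)
Lemma ratio_mean h : INR (cost (maximal h)) / INR (size (maximal h))
  = mean (S h) + (mean (S h) - 1) * / (2 ^ S h - 1).
Proof.
  assert (C := f_equal INR (cost_maximal h)).
  assert (Z := f_equal INR (size_maximal h)).
  rewrite S_INR in C, Z; rewrite INR_pow2 in Z; unfold mean; rewrite <- C, <- Z.
  replace (INR (size (maximal h)) + 1 - 1) with (INR (size (maximal h))) by lra.
  assert (0 < INR (size (maximal h))); [|field; lra].
  assert (1 <= 2 ^ h) by (apply pow_R1_Rle; lra).
  rewrite <- tech_pow_Rmult in Z; lra.
Qed.

Lemma ratio_cv alpha : Un_cv approx alpha ->
  Un_cv (fun h => INR (cost (maximal h)) / INR (size (maximal h))) alpha.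
Proof.
  intro H; apply mean_cv, Un_cv_S in H.
  apply (Un_cv_ext (fun h => mean (S h) + (mean (S h) - 1) * / (2 ^ S h - 1))).
  { intro h; symmetry; apply ratio_mean. }
  replace alpha with (alpha + (alpha - 1) * 0) by lra.
  apply CV_plus; [exact H|]; apply CV_mult.
  { apply CV_minus; [exact H | apply Un_cv_const]. }
  assert (B : forall n, INR n <= 2 ^ n - 1).
  { intro n; assert (P := poly n 1 ltac:(lra)); replace (1 + 1) with 2 in P by lra; lra. }
  apply cv_infty_cv_0.
  - intros M; destruct (INR_unbounded M) as [N HN]; exists N; intros n Hn.
    apply Rlt_le_trans with (INR N); [exact HN|].
    apply Rle_trans with (INR (S n)); [apply le_INR; lia | apply B].
Qed.

Close Scope R_scope.

(** * Evaluation *)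

(** Nested lists that carry the parity of their length, so that the test made at
    each step of the recursion for [delay] takes constant time.  The trees
    [cached (full n)] are linear in memory thanks to sharing. *)
Inductive ctree : Type := CNil | CSnoc (odd : bool) (l c : ctree).

Definition codd (t : ctree) : bool :=
  match t with CNil => false | CSnoc b _ _ => b end.

Definition csnoc (l c : ctree) : ctree := CSnoc (negb (codd l)) l c.

Fixpoint cpairs (t : ctree) : ctree :=
  match t with
  | CNil => CNil
  | CSnoc _ CNil c => c
  | CSnoc _ (CSnoc _ l c1) c2 => csnoc (cpairs l) (csnoc c1 c2)
  end.

Fixpoint cached (t : bin) : ctree :=
  match t with Nil => CNil | Snoc l c => csnoc (cached l) (cached c) end.

Lemma codd_cached t : codd (cached t) = Nat.odd (len t).
Proof.
  induction t as [|l IH c _]; [reflexivity|].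
  cbn [cached csnoc codd len]; now rewrite odd_S, IH.
Qed.

Lemma cpairs_cached t : cpairs (cached t) = cached (pairs t).
Proof.
  induction t as [|c|l c1 c2 IH] using bin_pair_ind; [reflexivity..|].
  cbn [cached csnoc cpairs pairs]; now rewrite IH.
Qed.

(** [k + delay t], if the nesting of the recursion does not exceed [fuel]. *)
Fixpoint add_delay (fuel : nat) (k : N) (t : ctree) : option N :=
  match fuel with
  | 0 => None
  | S fuel =>
      match t with
      | CSnoc false l c =>
          match add_delay fuel (N.succ k) c with
          | Some k => add_delay fuel k (cpairs l)
          | None => None
          end
      | _ => Some (N.succ k)
      end
  end.

Lemma add_delay_cached fuel k t m :
  add_delay fuel k (cached t) = Some m -> m = (k + N.of_nat (delay t))%N.
Proof.
  revert k t m; induction fuel as [|fuel IH]; intros k t m; [discriminate|].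
  destruct t as [|l c]; [intros [= <-]; rewrite delay_Nil; lia|].
  cbn [cached csnoc add_delay]; rewrite codd_cached.
  destruct (Nat.odd (len l)) eqn:E; cbn [negb].
  - destruct (add_delay fuel (N.succ k) (cached c)) as [m'|] eqn:Ec; [|discriminate].
    rewrite cpairs_cached; intro Ep.
    apply IH in Ec, Ep; rewrite (delay_even l c E); lia.
  - intros [= <-]; rewrite delay_odd; [lia|].
    cbn [len]; now rewrite odd_S, E.
Qed.

Definition cdouble (t : ctree) : ctree := csnoc t t.

(** Horner evaluation of the terms of the series for the next [count] full
    trees, starting from [t]. *)
Fixpoint numerators (fuel count : nat) (t : ctree) (a : N) : option N :=
  match count with
  | 0 => Some a
  | S count =>
      match add_delay fuel (N.double a) t with
      | Some a => numerators fuel count (cdouble t) a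
      | None => None
      end
  end.

Lemma cached_iter k n :
  N.iter k cdouble (cached (full n)) = cached (full (N.to_nat k + n)).
Proof.
  induction k as [|k IH] using N.peano_ind; [reflexivity|].
  rewrite N.iter_succ, IH, N2Nat.inj_succ; reflexivity.
Qed.

(** The bound 1024 is a convenient power of two above all the delays that
    occur. *)
Fixpoint bounded (fuel count : nat) (step : N) (t : ctree) : bool :=
  match count with
  | 0 => true
  | S count =>
      match add_delay fuel 0 t with
      | Some k => (k <=? 1024)%N && bounded fuel count step (N.iter step cdouble t)
      | None => false
      end
  end.

Lemma bounded_correct fuel count step n :
  bounded fuel count step (cached (full n)) = true ->
  forall i, i < count -> delay (full (n + i * N.to_nat step)) <= 1024.
Proof.
  revert n; induction count as [|count IH]; intros n H i Hi; [lia|].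
  cbn [bounded] in H.
  destruct (add_delay fuel 0 (cached (full n))) as [k|] eqn:E; [|discriminate].
  apply andb_prop in H as [Hk H]; apply add_delay_cached in E; apply N.leb_le in Hk.
  rewrite cached_iter in H.
  destruct i as [|i]; [rewrite Nat.add_0_r; lia|].
  replace (n + S i * N.to_nat step) with (N.to_nat step + n + i * N.to_nat step) by lia.
  apply (IH _ H); lia.
Qed.

Fixpoint clive (j : nat) (t : ctree) : bool :=
  match j with
  | 0 => true
  | S j => match t with CSnoc false l _ => clive j (cpairs l) | _ => false end
  end.

Lemma clive_cached j t : clive j (cached t) = true -> live j t.
Proof.
  revert t; induction j as [|j IH]; intros t H; [exact I|].
  destruct t as [|l c]; [discriminate|].
  cbn [clive cached csnoc] in H; rewrite codd_cached in H.
  destruct (Nat.odd (len l)) eqn:E; [|discriminate].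
  cbn [negb] in H; rewrite cpairs_cached in H.
  repeat split; [easy| |now apply IH].
  cbn [len]; now rewrite odd_S, E.
Qed.

Lemma live_4422 : live 12 (full (N.to_nat 4422)).
Proof.
  apply clive_cached; rewrite <- (Nat.add_0_r (N.to_nat 4422)), <- cached_iter.
  vm_compute; reflexivity.
Qed.

(** [full 4422] is a common beginning of all the larger full trees, so the
    survivors lie in the residue class of 4422. *)
Lemma live_mod_4422 j n : j <= 12 -> N.to_nat 4422 <= n -> live j (full n) ->
  exists i, n = N.to_nat 4422 + i * 2 ^ j.
Proof.
  intros Hj Hn L.
  assert (E := extends_full (N.to_nat 4422) (n - N.to_nat 4422)).
  replace (n - N.to_nat 4422 + N.to_nat 4422) with n in E by lia.
  destruct (live_congruent j (full (N.to_nat 4422)) (n - N.to_nat 4422) 0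
    (full n) (full (N.to_nat 4422))) as [z Hz]; auto.
  - rewrite len_full; transitivity (2 ^ 12); [apply Nat.pow_le_mono_r; lia|].
    change (2 ^ 12) with (N.to_nat 4096); lia.
  - constructor.
  - apply (live_le j 12); [exact Hj | exact live_4422].
  - exists (Z.to_nat z); nia.
Qed.

(** The survivors of 9 rounds in this range are among the seven numbers
    [10566 + 512 * i]; for all others [delay_full_stage] suffices. *)
Lemma delay_le_512 n : (10512 <= N.of_nat n < 14096)%N -> delay (full n) <= 2 ^ 513.
Proof.
  intro Hn.
  destruct (delay_full_stage n 9) as [[_ D]|[L _]]; [simpl; lia | exact D |].
  destruct (live_mod_4422 9 n) as [i Hi]; [lia..| exact L |].
  assert (B : bounded 100 7 512 (cached (full (N.to_nat 10566))) = true).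
  { rewrite <- (Nat.add_0_r (N.to_nat 10566)), <- cached_iter.
    vm_compute; reflexivity. }
  transitivity (2 ^ 10); [|apply Nat.pow_le_mono_r; lia].
  change (2 ^ 9) with (N.to_nat 512) in Hi.
  replace n with (N.to_nat 10566 + (i - 12) * N.to_nat 512) by lia.
  apply (bounded_correct _ _ _ _ B); lia.
Qed.

(** The survivors of 12 rounds in this range are among the six numbers
    [16710 + 4096 * i]. *)
Lemma delay_le_4096 n : (14096 <= N.of_nat n < 40960)%N ->
  delay (full n) <= 2 ^ N.to_nat 4097.
Proof.
  intro Hn.
  destruct (delay_full_stage n 12) as [[_ D]|[L _]].
  - change (2 ^ 13) with (N.to_nat 8192); lia.
  - replace (N.to_nat 4097) with (S (2 ^ 12)); [exact D|].
    change (2 ^ 12) with (N.to_nat 4096); lia.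
  - destruct (live_mod_4422 12 n) as [i Hi]; [lia..| exact L |].
    assert (B : bounded 100 6 4096 (cached (full (N.to_nat 16710))) = true).
    { rewrite <- (Nat.add_0_r (N.to_nat 16710)), <- cached_iter.
      vm_compute; reflexivity. }
    transitivity (2 ^ 10); [|apply Nat.pow_le_mono_r; lia].
    change (2 ^ 12) with (N.to_nat 4096) in Hi.
    replace n with (N.to_nat 16710 + (i - 3) * N.to_nat 4096) by lia.
    apply (bounded_correct _ _ _ _ B); lia.
Qed.

Definition block_start (k : nat) : ctree :=
  N.iter (N.of_nat k * 144) cdouble CNil.

(** The terms up to [n = 10512 = 73 * 144], cut into blocks so that each is
    checked by a conversion of moderate size. *)
Definition blocks : list N :=
  Eval vm_compute in
    map (fun k => match numerators 100 144 (block_start k) 0 with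
                  | Some c => c
                  | None => 0%N
                  end) (seq 0 73).

Lemma numerators_block k : k < 73 ->
  numerators 100 144 (block_start k) 0 = Some (nth k blocks 0%N).
Proof.
  intro Hk.
  do 73 (destruct k as [|k]; [vm_compute; reflexivity|]).
  lia.
Qed.

Fixpoint joined (k : nat) : N :=
  match k with
  | O => 1%N
  | S k => (N.shiftl (joined k) 144 + nth k blocks 0)%N
  end.

Open Scope R_scope.

Lemma numerators_correct fuel count n a b :
  numerators fuel count (cached (full n)) a = Some b ->
  approx (count + n) - IZR (Z.of_N b) / 2 ^ (count + n)
  = approx n - IZR (Z.of_N a) / 2 ^ n.
Proof.
  revert n a; induction count as [|count IH]; intros n a H.
  - now injection H as <-.
  - cbn [numerators] in H.
    destruct (add_delay fuel (N.double a) (cached (full n))) as [a'|] eqn:E;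
      [|discriminate].
    apply add_delay_cached in E.
    change (cdouble (cached (full n))) with (cached (full (S n))) in H.
    replace (S count + n)%nat with (count + S n)%nat by lia.
    rewrite N.double_spec in E.
    rewrite (IH _ _ H), approx_S, E.
    rewrite N2Z.inj_add, N2Z.inj_mul, nat_N_Z, plus_IZR, mult_IZR, <- INR_IZR_INZ.
    rewrite <- (tech_pow_Rmult 2 n); field; apply Rgt_not_eq, pow2_pos.
Qed.

Lemma pow2_IZR n : IZR (2 ^ Z.of_N n) = 2 ^ N.to_nat n.
Proof. rewrite <- (N_nat_Z n), <- pow_IZR; reflexivity. Qed.

Lemma approx_block k : (k < 73)%nat ->
  approx (144 + k * 144)
  = approx (k * 144) + IZR (Z.of_N (nth k blocks 0%N)) / 2 ^ (144 + k * 144).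
Proof.
  intro Hk; assert (B := numerators_block k Hk).
  replace (block_start k) with (cached (full (N.to_nat (N.of_nat k * 144) + 0))) in B
    by (symmetry; exact (cached_iter (N.of_nat k * 144) 0)).
  apply numerators_correct in B; change (Z.of_N 0) with 0%Z in B.
  replace (N.to_nat (N.of_nat k * 144) + 0)%nat with (k * 144)%nat in B by lia.
  unfold Rdiv in *; lra.
Qed.

Lemma approx_joined k : (k <= 73)%nat ->
  approx (k * 144) = IZR (Z.of_N (joined k)) / 2 ^ (k * 144).
Proof.
  induction k as [|k IH]; intro Hk; [rewrite Nat.mul_0_l, approx_0; simpl; lra|].
  rewrite Nat.mul_succ_l, Nat.add_comm, approx_block, IH by lia; cbn [joined].
  rewrite N.shiftl_mul_pow2, N2Z.inj_add, N2Z.inj_mul, N2Z.inj_pow, plus_IZR, mult_IZR.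
  change (Z.of_N 2) with 2%Z; rewrite pow2_IZR, pow_add.
  change (N.to_nat 144) with 144%nat.
  assert (P := pow2_pos 144); assert (P' := pow2_pos (k * 144)).
  revert P P'; generalize (2 ^ 144) (2 ^ (k * 144)); intros x y P P'.
  field; lra.
Qed.

(** The fraction that the literal in [alpha_digits] stands for. *)
Definition digits : Q :=
  ltac:(let r := eval unfold alpha_digits in alpha_digits in
        match r with Q2R ?q => exact q end).

Lemma Qden_digits : Zpos (Qden digits) = (10 ^ 3007)%Z.
Proof. vm_compute; reflexivity. Qed.

(** For [d > 0]: [m / d <= a / 2 ^ 10512] and
    [(a + 2 ^ 515) / 2 ^ 10512 < (m + 1) / d], where [2 ^ 515] leaves room for the
    tail of the series. *)
Definition bracketed (m d a : Z) : bool :=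
  let p := (d * a)%Z in
  (Z.shiftl m (Z.of_N 10512) <=? p)%Z &&
  (p + Z.shiftl d (Z.of_N 515) <? Z.shiftl (m + 1) (Z.of_N 10512))%Z.

Lemma bracketed_bounds m d a : (0 < d)%Z -> bracketed m d a = true ->
  IZR m / IZR d <= IZR a / 2 ^ N.to_nat 10512 /\
  IZR a / 2 ^ N.to_nat 10512 + 4 / 2 ^ N.to_nat 9999 < IZR m / IZR d + / IZR d.
Proof.
  intros Hd B; apply andb_prop in B as [B1 B2].
  apply Z.leb_le, IZR_le in B1; apply Z.ltb_lt, IZR_lt in B2; apply IZR_lt in Hd.
  rewrite Z.shiftl_mul_pow2 in B1 by apply N2Z.is_nonneg.
  rewrite 2 Z.shiftl_mul_pow2 in B2 by apply N2Z.is_nonneg.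
  rewrite !mult_IZR, !pow2_IZR in B1.
  rewrite plus_IZR, !mult_IZR, plus_IZR, !pow2_IZR in B2.
  assert (P := pow2_pos (N.to_nat 10512)).
  assert (S : 4 / 2 ^ N.to_nat 9999 = 2 ^ N.to_nat 515 / 2 ^ N.to_nat 10512).
  { replace (N.to_nat 10512) with (N.to_nat 513 + N.to_nat 9999)%nat by lia.
    replace (N.to_nat 515) with (2 + N.to_nat 513)%nat by lia.
    rewrite !pow_add; field; split; apply Rgt_not_eq, pow2_pos. }
  rewrite S; clear S.
  set (e := 2 ^ N.to_nat 10512) in *; set (f := 2 ^ N.to_nat 515) in *.
  set (x := IZR a) in *; set (y := IZR d) in *; set (z := IZR m) in *.
  clearbody e f x y z.
  split.
  - apply Rmult_le_reg_r with (y * e); [now apply Rmult_lt_0_compat|].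
    replace (z / y * (y * e)) with (z * e) by (field; lra).
    replace (x / e * (y * e)) with (y * x) by (field; lra); exact B1.
  - apply Rmult_lt_reg_r with (y * e); [now apply Rmult_lt_0_compat|].
    replace ((x / e + f / e) * (y * e)) with (y * x + y * f) by (field; lra).
    replace ((z / y + / y) * (y * e)) with ((z + 1) * e) by (field; lra); exact B2.
Qed.

Lemma digits_bracketed :
  bracketed (Qnum digits) (Zpos (Qden digits)) (Z.of_N (joined 73)) = true.
Proof. vm_compute; reflexivity. Qed.

Lemma approx_10512 :
  approx (N.to_nat 10512) = IZR (Z.of_N (joined 73)) / 2 ^ N.to_nat 10512.
Proof.
  replace (N.to_nat 10512) with (73 * 144)%nat by lia.
  exact (approx_joined 73 (Nat.le_refl 73)).
Qed.

Lemma alpha_digits_fraction : alpha_digits = IZR (Qnum digits) / IZR (Zpos (Qden digits)).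
Proof. reflexivity. Qed.

Lemma pow_10_3007 : 10 ^ 3007 = IZR (Zpos (Qden digits)).
Proof. rewrite Qden_digits; exact (pow_IZR 10 3007). Qed.

Lemma approx_10512_bounds :
  alpha_digits <= approx (N.to_nat 10512) /\
  approx (N.to_nat 10512) + 4 / 2 ^ N.to_nat 9999 < alpha_digits + / 10 ^ 3007.
Proof.
  rewrite approx_10512, alpha_digits_fraction, pow_10_3007.
  apply bracketed_bounds; [reflexivity | exact digits_bracketed].
Qed.

(** The ranges up to 14096, up to 40960, and beyond contribute at most [/ 2 ^ 9999]
    each; the thresholds are 9999 above the exponents of the bounds for the
    delay. *)
Lemma approx_le n : approx n <= approx (N.to_nat 10512) + 3 / 2 ^ N.to_nat 9999.
Proof.
  assert (H1 : approx (N.to_nat 14096)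
    <= approx (N.to_nat 10512) + 2 ^ 513 / 2 ^ N.to_nat 10512).
  { apply approx_le_range; [lia|]; intros; apply delay_le_512; lia. }
  assert (H2 : approx (N.to_nat 40960)
    <= approx (N.to_nat 14096) + 2 ^ N.to_nat 4097 / 2 ^ N.to_nat 14096).
  { apply approx_le_range; [lia|]; intros; apply delay_le_4096; lia. }
  assert (H3 := approx_le_tail (N.to_nat 10240) n ltac:(lia)).
  replace (4 * N.to_nat 10240)%nat with (N.to_nat 40960) in H3 by lia.
  assert (E1 : 2 ^ 513 / 2 ^ N.to_nat 10512 = / 2 ^ N.to_nat 9999).
  { replace (N.to_nat 10512) with (513 + N.to_nat 9999)%nat by lia.
    rewrite pow_add; field; repeat split; apply Rgt_not_eq, pow2_pos. }
  assert (E2 : 2 ^ N.to_nat 4097 / 2 ^ N.to_nat 14096 = / 2 ^ N.to_nat 9999).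
  { replace (N.to_nat 14096) with (N.to_nat 4097 + N.to_nat 9999)%nat by lia.
    rewrite pow_add; field; repeat split; apply Rgt_not_eq, pow2_pos. }
  assert (E3 : 8 / 2 ^ N.to_nat 10240 <= / 2 ^ N.to_nat 9999).
  { replace (N.to_nat 10240) with (3 + (238 + N.to_nat 9999))%nat by lia.
    rewrite (pow_add 2 3); replace (2 ^ 3) with 8 by lra.
    replace (8 / (8 * 2 ^ (238 + N.to_nat 9999))) with (/ 2 ^ (238 + N.to_nat 9999))
      by (field; apply Rgt_not_eq, pow2_pos).
    apply Rinv_le_contravar; [apply pow2_pos | apply Rle_pow; [lra | lia]]. }
  unfold Rdiv at 1; lra.
Qed.

Theorem lemma1 :
  exists alpha : R,
    Un_cv (fun h : nat => INR (cost (maximal h)) / INR (size (maximal h))) alpha /\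
    alpha_digits <= alpha < alpha_digits + / 10 ^ 3007.
Proof.
  destruct approx_cv as [alpha H]; exists alpha; split; [now apply ratio_cv|].
  destruct approx_10512_bounds as [L U]; split.
  - apply Rle_trans with (1 := L), (growing_ineq approx); [exact approx_growing | exact H].
  - apply Rle_lt_trans with (approx (N.to_nat 10512) + 3 / 2 ^ N.to_nat 9999).
    + apply (@Rle_cv_lim approx
        (fun _ => approx (N.to_nat 10512) + 3 / 2 ^ N.to_nat 9999)).
      * exact approx_le.
      * exact H.
      * apply Un_cv_const.
    + apply Rlt_trans with (2 := U), Rplus_lt_compat_l, Rmult_lt_compat_r; [|lra].
      apply Rinv_0_lt_compat, pow2_pos.
Qed.
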